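(* Let $\kappa\in[0,1)$ and $\epsilon,\delta>0$. No (possibly randomized) polynomial-time algorithm with value-oracle access can achieve an approximation factor of $\frac{n^{1-3\epsilon}}{1+(n^{1-3\epsilon}-1)(1-\kappa)+\delta\kappa}$ for the minimum submodular spanning tree problem with submodular functions of curvature $\kappa$: given a graph $\mathcal G=(\mathcal V,\mathcal E)$ with $n=|\mathcal V|$ and a nonnegative monotone submodular $f:2^{\mathcal E}\to\mathbb{R}$ with $f(\emptyset)=0$ and curvature $\kappa$, find a spanning tree $X\subseteq\mathcal E$ minimizing $f(X)$.
   Context: In the value-oracle model the algorithm accesses $f$ only by queries returning $f(S)$; polynomial-time means polynomial in the size of the graph. Curvature: $\kappa_f = 1-\min_{e\in\mathcal E}\frac{f(e\mid \mathcal E\setminus\{e\})}{f(\{e\})}$ with $f(e\mid S)=f(S\cup\{e\})-f(S)$.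
   Formalization: For curvature κ = 0 the factor equals 1 and f is modular, so Kruskal's algorithm attains it and the claim is false; in that case the theorem only says that no polynomial-time algorithm achieves a ratio strictly better than the factor. *)

(* Defs.v *)
From HB Require Import structures.
From mathcomp Require Import all_boot all_order all_algebra.
From mathcomp Require Import boolp classical_sets reals exp.

Set Implicit Arguments.
Unset Strict Implicit.
Unset Printing Implicit Defensive.

Import Order.TTheory GRing.Theory Num.Theory.

Local Open Scope ring_scope.

(* Finite simple graphs, presented as an algorithm receives them: the vertices
   are 0, ..., nv - 1 and the edges are listed, without repetition, as pairs
   (u, v) with u < v. A set of edges is a set of edge indices. *)
Record sgraph := SGraph {
  nv : nat;
  ne : nat;
  ends : 'I_ne -> 'I_nv * 'I_nv;
  ends_lt : forall i, ((ends i).1 < (ends i).2)%N;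
  ends_inj : injective ends
}.

Definition edge_set (G : sgraph) := {set 'I_(ne G)}.

Definition graph_size (G : sgraph) : nat := (nv G + ne G)%N.

Definition adj (G : sgraph) (X : edge_set G) : rel 'I_(nv G) :=
  fun u v => [exists i in X, (ends i == (u, v)) || (ends i == (v, u))].

Definition connected (G : sgraph) (X : edge_set G) : Prop :=
  forall u v, connect (adj X) u v.

(* The length bound excludes the closed walk u, v, u along a single edge. *)
Definition acyclic (G : sgraph) (X : edge_set G) : Prop :=
  forall c : seq 'I_(nv G), (2 < size c)%N -> ~ ucycle (adj X) c.

Definition spanning_tree (G : sgraph) (X : edge_set G) : Prop :=
  connected X /\ acyclic X.

Section SetFunctions.
Variables (R : realType) (T : finType).
Implicit Types f : {set T} -> R.

Definition monotone f := forall A B : {set T}, A \subset B -> f A <= f B.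

Definition submodular f :=
  forall A B : {set T}, f (A :|: B) + f (A :&: B) <= f A + f B.

Definition marginal f (e : T) (A : {set T}) : R := f (e |: A) - f A.

Definition curvature_ratio f (e : T) : R :=
  marginal f e (~: [set e]) / f [set e].

(* The infimum of a finite nonempty set of reals is its minimum. For a
   nonnegative monotone f, curvature f < 1 forces f [set e] > 0 for every e
   (as x / 0 = 0) and T to be inhabited (as inf set0 = 0). *)
Definition curvature f : R := 1 - inf (range (curvature_ratio f)).

End SetFunctions.

Section Problem.
Variable R : realType.

Record instance (kappa : R) (G : sgraph) (f : edge_set G -> R) : Prop := {
  inst_connected : connected [set: 'I_(ne G)];
  inst_ge0 : forall X, 0 <= f X;
  inst_set0 : f finset.set0 = 0;
  inst_monotone : monotone f;
  inst_submodular : submodular f;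
  inst_curvature : curvature f = kappa
}.

Definition opt (G : sgraph) (f : edge_set G -> R) : R :=
  inf [set f X | X in [set X | spanning_tree X]]%classic.

End Problem.

(* Algorithms are programs of a randomized real-number random-access machine
   with a value oracle. The machine has a memory of natural numbers and a
   memory of reals, both initially 0, random access to the edge list of the
   graph, fair coin flips, and a unit-cost instruction returning f S, where S
   is the set of the edges i whose flag in an array is nonzero. There is no
   multiplication on the natural-number memory, so that in polynomial time its
   cells only hold numbers of polynomial bit length. *)
Section Machine.
Variable R : realType.

(* Operands are addresses: r is the target cell, and l is a code location. *)
Inductive instr :=
| NConst (r k : nat)
| NAdd (r a b : nat)
| NSub (r a b : nat)
| NLoad (r a : nat)
| NStore (a b : nat)
| NumVertices (r : nat)
| NumEdges (r : nat)
| EdgeFst (r a : nat)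
| EdgeSnd (r a : nat)
| RConst (r : nat) (x : R)
| ROfNat (r a : nat)
| RAdd (r a b : nat)
| RSub (r a b : nat)
| RMul (r a b : nat)
| RDiv (r a b : nat)
| RLoad (r a : nat)
| RStore (a b : nat)
| JumpNLe (a b l : nat)
| JumpRLe (a b l : nat)
| Flip (r : nat)
| Query (r a : nat)
| Halt (a : nat).

Definition program := seq instr.

Record state := State { pc : nat; nmem : nat -> nat; rmem : nat -> R }.

Definition init_state : state := State 0 (fun=> 0%N) (fun=> 0).

Section Run.
Variables (prog : program) (G : sgraph) (f : edge_set G -> R).

Definition edge_endpoint (p : 'I_(nv G) * 'I_(nv G) -> 'I_(nv G)) (i : nat) :
    nat :=
  if (insub i : option 'I_(ne G)) is Some e then p (ends e) else 0%N.

Definition read_set (m : nat -> nat) (base : nat) : edge_set G :=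
  [set i : 'I_(ne G) | m (base + i)%N != 0%N].

Inductive outcome := Running of state | Halted of edge_set G.

(* The bit coin is a fresh fair coin, used only by Flip. Running past the end
   of the program halts. *)
Definition step (coin : bool) (s : state) : outcome :=
  let m := nmem s in
  let x := rmem s in
  let next := (pc s).+1 in
  let setn r k := Running (State next [eta m with r |-> k] x) in
  let setr r y := Running (State next m [eta x with r |-> y]) in
  let jump (c : bool) l := Running (State (if c then l else next) m x) in
  match nth (Halt 0) prog (pc s) with
  | NConst r k => setn r k
  | NAdd r a b => setn r (m a + m b)%N
  | NSub r a b => setn r (m a - m b)%N
  | NLoad r a => setn r (m (m a))
  | NStore a b => setn (m a) (m b)
  | NumVertices r => setn r (nv G)
  | NumEdges r => setn r (ne G)
  | EdgeFst r a => setn r (edge_endpoint fst (m a))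
  | EdgeSnd r a => setn r (edge_endpoint snd (m a))
  | RConst r y => setr r y
  | ROfNat r a => setr r (m a)%:R
  | RAdd r a b => setr r (x a + x b)
  | RSub r a b => setr r (x a - x b)
  | RMul r a b => setr r (x a * x b)
  | RDiv r a b => setr r (x a / x b)
  | RLoad r a => setr r (x (m a))
  | RStore a b => setr (m a) (x b)
  | JumpNLe a b l => jump (m a <= m b)%N l
  | JumpRLe a b l => jump (x a <= x b) l
  | Flip r => setn r (nat_of_bool coin)
  | Query r a => setr r (f (read_set m (m a)))
  | Halt a => Halted (read_set m (m a))
  end.

Fixpoint run_from (s : state) (coins : seq bool) : option (edge_set G) :=
  if coins is c :: coins' then
    match step c s with
    | Running s' => run_from s' coins'
    | Halted X => Some X
    end
  else None.

(* The output within size coins steps, or None if the program is still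
   running. *)
Definition run (coins : seq bool) : option (edge_set G) :=
  run_from init_state coins.

End Run.

Definition polynomial_bound (t : sgraph -> nat) : Prop :=
  exists c d : nat, forall G, (t G <= c * graph_size G ^ d + c)%N.

Definition runs_in_time (kappa : R) (prog : program) (t : sgraph -> nat) :
    Prop :=
  forall (G : sgraph) (f : edge_set G -> R), instance kappa f ->
  forall coins : (t G).-tuple bool, run prog f coins <> None.

(* Below, t is a running time of prog, so that a uniformly random tuple of t G
   coins determines the output of prog on G. *)
Section Guarantees.
Variables (prog : program) (t : sgraph -> nat).
Variables (G : sgraph) (f : edge_set G -> R).

Definition probability (P : pred ((t G).-tuple bool)) : R :=
  #|[set w | P w]|%:R / 2 ^+ t G.

Definition expected_value : R :=
  (\sum_(w : (t G).-tuple bool)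
     if run prog f w is Some X then f X else 0) / 2 ^+ t G.

(* The approximation ratio is at most rho if incl holds, and less than rho
   otherwise. *)
Definition within_factor (incl : bool) (rho v : R) : bool :=
  v < rho * opt f ?<= if incl.

Definition good_in_expectation (incl : bool) (rho : R) : Prop :=
  (forall w : (t G).-tuple bool,
     exists2 X, run prog f w = Some X & spanning_tree X)
  /\ within_factor incl rho expected_value.

Definition good_with_probability (incl : bool) (rho p : R) : Prop :=
  p <= probability (fun w =>
         if run prog f w is Some X
         then `[< spanning_tree X >] && within_factor incl rho (f X)
         else false).

End Guarantees.

(* The factor rho depends on the number of vertices and is only required of
   large graphs: for fixed parameters a small graph may have rho < 1, which no
   algorithm achieves. A randomized algorithm may meet the factor either in
   expectation or with some constant positive probability. *)
Definition achieves_factor (incl : bool) (kappa : R) (prog : program)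
    (t : sgraph -> nat) (rho : nat -> R) : Prop :=
  exists n0 : nat,
    (forall (G : sgraph) (f : edge_set G -> R),
       (n0 <= nv G)%N -> instance kappa f ->
       good_in_expectation prog t f incl (rho (nv G)))
    \/
    (exists2 p : R, 0 < p &
     forall (G : sgraph) (f : edge_set G -> R),
       (n0 <= nv G)%N -> instance kappa f ->
       good_with_probability prog t f incl (rho (nv G)) p).

End Machine.

Definition hardness_factor (R : realType) (kappa eps delta : R) (n : nat) : R :=
  let N := n%:R `^ (1 - 3 * eps) in
  N / (1 + (N - 1) * (1 - kappa) + delta * kappa).

(* Main.v *)
Require Import Defs.
From mathcomp Require Import boolp classical_sets.
From mathcomp Require Import all_boot all_order all_algebra.
From mathcomp Require Import reals sequences exp zify ring lra.

Set Implicit Arguments.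
Unset Strict Implicit.
Unset Printing Implicit Defensive.

Import Order.TTheory GRing.Theory Num.Theory.

Local Open Scope ring_scope.

(* A recursive tree R on the complete graph with n = 2 ^ L vertices is hidden:
   every vertex v > 0 draws a parent among the smaller ones. Layer j consists of
   the edges whose larger endpoint lies in [2 ^ j, 2 ^ (j + 1)). The cost of S
   is kappa F_R(S) + (1 - kappa) |S|, where, with S_j the part of S in layer j,
     F_R(S) = sum_j min (|S_j \ R| + min (b, |S_j /\ R|), 2 ^ (j + 1))
   and b is a multiple of L = log n. The tree R costs at most
   kappa L b + (1 - kappa) (n - 1).
   Replacing R by the empty set gives a decoy cost that carries no information
   and for which every spanning tree costs at least n - 1. The two costs differ
   at S only if some S_j has fewer than 3 * 2 ^ j edges and at least b of them
   lie in R. Since an edge of layer j is in R with probability at most 2 ^ - j,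
   the mean of 2 ^ |S_j /\ R| is then at most e ^ 3, so this has probability at
   most L e ^ 3 / 2 ^ b, less than any given inverse power of n for suitable
   b. Hence some R is missed by all but a 1 / n fraction of the runs against the
   decoy, and these runs output a tree of cost at least n - 1. *)

Lemma card_ord_ltn (n k : nat) : #|[set v : 'I_n | (v < k)%N]| = minn k n.
Proof.
rewrite cardsE; have [kn|nk] := leqP k n.
  rewrite -sum1_card (eq_bigl (fun v : 'I_n => (v < k)%N)) => [|v].
    by rewrite (big_ord_narrow kn) /= sum1_card card_ord.
  by [].
rewrite -[RHS](card_ord n); apply: eq_card => v.
exact: ltn_trans (ltn_ord v) nk.
Qed.

(** * Queries made by a run *)

Section Trace.
Variables (R : realType) (prog : program R) (G : sgraph).
Implicit Types (f g : edge_set G -> R) (s : state R).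

(** The set returned by [Halt] counts as a probe, so two costs that agree on the trace give the same
    output and also the same cost of it. *)
Definition probes s : seq (edge_set G) :=
  match nth (Halt R 0) prog (pc s) with
  | Query _ a | Halt a => [:: read_set G (nmem s) (nmem s a)]
  | _ => [::]
  end.

Fixpoint trace f s (coins : seq bool) : seq (edge_set G) :=
  if coins is b :: coins' then
    probes s ++
    (if step prog f b s is Running s' then trace f s' coins' else [::])
  else [::].

Lemma size_trace f s coins : (size (trace f s coins) <= size coins)%N.
Proof.
elim: coins s => //= b coins IH s; rewrite size_cat -add1n leq_add //.
  by rewrite /probes; case: nth.
by case: step.
Qed.

Lemma eq_step f g b s :
  {in probes s, f =1 g} -> step prog f b s = step prog g b s.
Proof.
rewrite /probes /step; case: nth => // r a eqfg.
by rewrite eqfg ?mem_head.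
Qed.

Lemma step_halted f b s X : step prog f b s = Halted R X -> X \in probes s.
Proof. by rewrite /probes /step; case: nth => // a [<-]; rewrite mem_head. Qed.

Lemma eq_run_from f g s coins :
  {in trace f s coins, f =1 g} ->
  run_from prog f s coins = run_from prog g s coins.
Proof.
elim: coins s => //= b coins IH s eqfg.
have <- : step prog f b s = step prog g b s.
  by apply: eq_step => S Sin; apply: eqfg; rewrite mem_cat Sin.
case E: (step prog f b s) => [s'|//].
by apply: IH => S Sin; apply: eqfg; rewrite mem_cat E Sin orbT.
Qed.

Lemma run_from_trace f s coins X :
  run_from prog f s coins = Some X -> X \in trace f s coins.
Proof.
elim: coins s => //= b coins IH s; rewrite mem_cat.
case E: (step prog f b s) => [s'|Y]; first by move/IH => ->; rewrite orbT.
by case=> <-; rewrite (step_halted E).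
Qed.

End Trace.

(** * Truncated cardinalities *)

Section CapBound.
Variable T : finType.
Implicit Types (R S A B : {set T}).

Definition capped_card (b a : nat) R S :=
  minn (#|S :\: R| + minn b #|S :&: R|) a.

Lemma capped_card_mono b a R A B :
  A \subset B -> (capped_card b a R A <= capped_card b a R B)%N.
Proof.
move=> AB; have := subset_leq_card (setSD R AB).
have := subset_leq_card (setSI R AB); rewrite /capped_card; lia.
Qed.

(** Cardinalities inside and outside [R] are modular, and truncating a monotone submodular function
    at a constant keeps it submodular. Given the modular identities and monotonicity, linear
    arithmetic suffices. *)
Lemma capped_card_submod b a R A B :
  (capped_card b a R (A :|: B) + capped_card b a R (A :&: B) <=
   capped_card b a R A + capped_card b a R B)%N.
Proof.
have card_eq C : (#|(A :|: B) :&: C| + #|(A :&: B) :&: C| =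
                  #|A :&: C| + #|B :&: C|)%N.
  by rewrite setIUl setIIl cardsUI.
have mono C A' B' : A' \subset B' -> (#|A' :&: C| <= #|B' :&: C|)%N.
  by move=> AB'; apply/subset_leq_card/setSI.
have AU := subsetUl A B; have BU := subsetUr A B.
have IA := subsetIl A B; have IB := subsetIr A B.
rewrite /capped_card !setDE.
have := card_eq R; have := card_eq (~: R).
have := mono R _ _ AU; have := mono R _ _ BU.
have := mono R _ _ IA; have := mono R _ _ IB.
have := mono (~: R) _ _ AU; have := mono (~: R) _ _ BU.
have := mono (~: R) _ _ IA; have := mono (~: R) _ _ IB.
lia.
Qed.

Lemma capped_card_set0 b a R : capped_card b a R set0 = 0%N.
Proof. by rewrite /capped_card set0D set0I cards0 minn0 min0n. Qed.

End CapBound.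

(** * Exponential tail bound for independent choices *)

Section Hits.
Variables (R : realType) (I U : finType).

(* Markov's inequality for 2 ^ (number of hits), whose mean factorizes. *)
Lemma card_hits (Q : I -> {set U}) (P : {set U * I}) (b : nat) :
  (forall i, (0 < #|Q i|)%N) ->
  #|[set c in family Q | (b <= #|[set i | (c i, i) \in P]|)%N]|%:R * 2 ^+ b <=
  expR (\sum_i #|[set u in Q i | (u, i) \in P]|%:R / #|Q i|%:R)
  * #|family Q|%:R :> R.
Proof.
move=> Q0.
have cardfam : #|family Q|%:R = \prod_i #|Q i|%:R :> R.
  rewrite -sum1_card natr_sum.
  under [RHS]eq_bigr do rewrite -sum1_card natr_sum.
  by rewrite bigA_distr_big_dep; apply: eq_bigr => c _; rewrite big1.
have mgf : \sum_(c in family Q) 2 ^+ #|[set i | (c i, i) \in P]| =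
    \prod_i \sum_(u in Q i) 2 ^+ ((u, i) \in P) :> R.
  rewrite bigA_distr_big_dep; apply: eq_bigr => c _.
  rewrite prodrXr -sum1_card; congr (_ ^+ _).
  by rewrite big_mkcond /=; apply: eq_bigr => i _; rewrite inE; case: (_ \in _).
apply: (@le_trans _ _ (\sum_(c in family Q) 2 ^+ #|[set i | (c i, i) \in P]|)).
  rewrite -sum1_card natr_sum mulr_suml.
  rewrite [leRHS](bigID (fun c : {ffun I -> U} =>
      (b <= #|[set i | (c i, i) \in P]|)%N)) /=.
  rewrite -[leLHS]addr0; apply: lerD; last first.
    by apply: sumr_ge0 => c _; apply: exprn_ge0.
  rewrite (eq_bigl (fun c : {ffun I -> U} => (c \in family Q) &&
      (b <= #|[set i | (c i, i) \in P]|)%N)); last by move=> c; rewrite inE.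
  by apply: ler_sum => c /andP[_ ?]; rewrite mul1r ler_eXn2l // ltr1n.
rewrite mgf cardfam expR_sum -big_split /=.
apply: ler_prod => i _; apply/andP; split.
  by apply: sumr_ge0 => u _; apply: exprn_ge0.
have q0 : 0 < #|Q i|%:R :> R by rewrite ltr0n.
(* A hit weighs 2 and a miss 1, so with q the fraction of hits the factor is [#|Q i|] times 1 + q,
   and 1 + q <= e ^ q. *)
apply: (@le_trans _ _ ((1 + #|[set u in Q i | (u, i) \in P]|%:R / #|Q i|%:R)
   * #|Q i|%:R)); last by rewrite ler_pM2r // expR_ge1Dx.
rewrite mulrDl mul1r divfK ?gt_eqF // -!sum1_card !natr_sum.
rewrite [X in _ + X](eq_bigl (fun u => (u \in Q i) && ((u, i) \in P)));
  last by move=> u; rewrite inE.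
rewrite [X in _ + X]big_mkcondr -big_split /=.
by apply: ler_sum => u _; case: (_ \in P); rewrite ?expr1 ?expr0 ?addr0.
Qed.

End Hits.

(** * Counting edges of connected graphs *)

Section Connected.
Variables (G : sgraph) (X : edge_set G).

(** While [W] misses a vertex, some edge of [X] leaves it; absorbing the outer endpoint adds one
    vertex and removes at least that edge from the counted set. *)
Lemma connected_card (W : {set 'I_(nv G)}) : connected X -> W != set0 ->
  (nv G <= #|W| + #|[set e in X | ~~ ((ends e).1 \in W)
                                || ~~ ((ends e).2 \in W)]|)%N.
Proof.
move=> conX; have [k] := ubnP (nv G - #|W|); elim: k W => // k IH W.
move=> Wk /set0Pn[w wW].
have [WT|] := eqVneq W setT; first by rewrite {1}WT cardsT card_ord leq_addr.
rewrite -subTset => /subsetPn[z _ zW].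
have [u [v [uW vW uv]]] : exists u v, [/\ u \in W, v \notin W & adj X u v].
  have /connectP[p] := conX w z.
  elim: p w wW => [|y p IHp] w wW /=; first by move=> _ zw; rewrite zw wW in zW.
  move=> /andP[wy yp] zl; have [yW|yW] := boolP (y \in W); last by exists w, y.
  exact: IHp yW yp zl.
have ltW : (#|W| < nv G)%N.
  rewrite -[X in (_ < X)%N]card_ord -cardsT; apply: proper_card.
  by rewrite properT; apply: contraNneq zW => ->; rewrite inE.
have cU : #|v |: W| = #|W|.+1 by rewrite cardsU1 vW.
apply: leq_trans (IH (v |: W) _ _) _; first by rewrite cU; lia.
  by apply/set0Pn; exists v; rewrite setU11.
rewrite cU addSnnS leq_add2l; apply: proper_card; apply/properP; split.
  apply/subsetP => e; rewrite !inE => /andP[-> /=].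
  by case/orP => /norP[_ ->]; rewrite ?orbT.
case/existsP: uv => e /andP[eX /orP[] /eqP E]; exists e;
  by rewrite !inE ?eX E /= ?uW ?vW ?eqxx ?orbT // negb_and /= ?orbT ?negbK.
Qed.

End Connected.

(** * The layered cost *)

Section LayeredCost.
Variable G : sgraph.
Implicit Types (S T X : edge_set G).

Definition layer (j : nat) : edge_set G :=
  [set e | trunc_log 2 (ends e).2 == j].

Definition layered_cost (L b : nat) T S : nat :=
  (\sum_(j < L) capped_card b (2 ^ j.+1) T (S :&: layer j))%N.

Lemma layerP e j : (e \in layer j) = (2 ^ j <= (ends e).2 < 2 ^ j.+1)%N.
Proof.
rewrite inE; have v0 := leq_ltn_trans (leq0n _) (ends_lt e).
apply/eqP/idP => [<-|/trunc_log_eq ->//]; exact: trunc_log_bounds.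
Qed.

Lemma layered_cost_mono L b T S X :
  S \subset X -> (layered_cost L b T S <= layered_cost L b T X)%N.
Proof. by move=> SX; apply: leq_sum => j _; apply/capped_card_mono/setSI. Qed.

Lemma layered_cost_submod L b T S X :
  (layered_cost L b T (S :|: X) + layered_cost L b T (S :&: X) <=
   layered_cost L b T S + layered_cost L b T X)%N.
Proof.
rewrite -!big_split; apply: leq_sum => j _ /=.
by rewrite setIUl setIIl capped_card_submod.
Qed.

Lemma layered_cost_set0 L b T : layered_cost L b T set0 = 0%N.
Proof.
by rewrite /layered_cost big1 // => j _; rewrite set0I capped_card_set0.
Qed.

(** This normalization makes every curvature ratio of the hard cost a plain marginal. *)
Lemma layered_cost_set1 L b T e :
  (0 < b)%N -> (nv G <= 2 ^ L)%N -> layered_cost L b T [set e] = 1%N.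
Proof.
move=> b0 GL; have v0 := leq_ltn_trans (leq0n _) (ends_lt e).
have jL : (trunc_log 2 (ends e).2 < L)%N.
  have := trunc_logP (isT : 1 < 2)%N v0.
  move=> /leq_ltn_trans/(_ (leq_trans (ltn_ord _) GL)).
  by rewrite ltn_exp2l.
rewrite /layered_cost (bigD1 (Ordinal jL)) //= big1 ?addn0 => [|j ij].
  rewrite (_ : _ :&: _ = [set e]); last first.
    by apply/setIidPl; rewrite sub1set inE.
  rewrite /capped_card; have := cardsID T [set e]; rewrite cards1.
  have := expn_gt0 2 (trunc_log 2 (ends e).2); rewrite expnS /=; lia.
rewrite (_ : _ :&: _ = set0) ?capped_card_set0 //.
apply/setP => e'; rewrite !inE; case: eqP => // -> /=.
by apply/negbTE; apply: contraNneq ij => E; apply/eqP/val_inj.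
Qed.

Definition above (k : nat) X : edge_set G :=
  [set e in X | (2 ^ k <= (ends e).2)%N].

(* If layer k overflows its cap, the cap pays for the vertices below
   2 ^ k.+1, and the edges ending above are at least as many as the others. *)
Lemma connected_layers k X : connected X -> (0 < nv G)%N ->
  (nv G <= \sum_(j < k) minn #|X :&: layer j| (2 ^ j.+1) + #|above k X|.+1)%N.
Proof.
move=> conX G0.
have above_ge m : (nv G <= 2 ^ m + #|above m X|)%N.
  have := @connected_card G X [set v : 'I_(nv G) | (v < 2 ^ m)%N] conX.
  rewrite card_ord_ltn; have W0 : [set v : 'I_(nv G) | (v < 2 ^ m)%N] != set0.
    by apply/set0Pn; exists (Ordinal G0); rewrite inE expn_gt0.
  move=> /(_ W0) /leq_trans; apply; apply: leq_add; first exact: geq_minl.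
  apply/subset_leq_card/subsetP => e; rewrite !inE => /andP[-> /=].
  by rewrite -!leqNgt => /orP[/leq_trans-> //|//]; apply: ltnW (ends_lt e).
elim: k => [|k IH]; first by rewrite big_ord0 add0n -add1n -(expn0 2) above_ge.
rewrite big_ord_recr /=.
have [ovf|small] := leqP (2 ^ k.+1) #|X :&: layer k|.
  apply: leq_trans (above_ge k.+1) _.
  by rewrite -addnA (leq_trans _ (leq_addl _ _)) // leq_add2l.
have : (#|above k X| <= #|X :&: layer k| + #|above k.+1 X|)%N.
  rewrite -cardsUI; apply: leq_trans (leq_addr _ _).
  apply/subset_leq_card/subsetP => e; rewrite in_setU in_setI layerP !inE.
  by case: (e \in X) => //= ->; case: ltnP.
by rewrite -addnA addnS => le; apply: leq_trans IH _; rewrite leq_add2l ltnS.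
Qed.

(** With an empty tree nothing is discounted, so the cost is the sum in [connected_layers] at k = L,
    and no endpoint reaches [2 ^ L]. *)
Lemma connected_cost L b X : connected X -> (nv G <= 2 ^ L)%N ->
  (nv G <= (layered_cost L b set0 X).+1)%N.
Proof.
move=> conX GL; have [G0|] := posnP (nv G); first by rewrite G0.
move=> /(connected_layers L conX) /leq_trans; apply.
rewrite (_ : above L X = set0) ?cards0 ?addn1.
  rewrite ltnS; apply: leq_sum => j _.
  by rewrite /capped_card setD0 setI0 cards0 minn0 addn0.
apply/setP => e; rewrite !inE; apply/negbTE; rewrite negb_and -ltnNge.
by rewrite (leq_trans (ltn_ord _) GL) orbT.
Qed.

Lemma connected_size X : connected X -> (nv G <= #|X|.+1)%N.
Proof.
move=> conX; have [G0|G0] := posnP (nv G); first by rewrite G0.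
have := @connected_card G X [set Ordinal G0] conX.
rewrite cards1 add1n -card_gt0 cards1 => /(_ isT) /leq_trans; apply.
by rewrite ltnS; apply/subset_leq_card/subsetP => e; rewrite inE => /andP[].
Qed.

End LayeredCost.

(** * Recursive trees in the complete graph *)

Section CompleteGraph.
Variable n : nat.

Local Notation pairs := [pred p : 'I_n * 'I_n | p.1 < p.2]%N.

Lemma complete_ends_lt (i : 'I_#|pairs|) : ((enum_val i).1 < (enum_val i).2)%N.
Proof. exact: (enum_valP i). Qed.

Definition complete : sgraph := SGraph complete_ends_lt enum_val_inj.

Lemma completeP (u v : 'I_n) :
  (u < v)%N -> exists e : 'I_(ne complete), ends e = (u, v).
Proof.
move=> uv; have uvP : (u, v) \in pairs by [].
by exists (enum_rank_in uvP (u, v)); rewrite /= enum_rankK_in.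
Qed.

Lemma complete_size : (0 < n)%N -> (graph_size complete <= 2 * n ^ 2)%N.
Proof.
move=> n0; rewrite /graph_size /= mul2n -addnn leq_add //.
  by rewrite -mulnn leq_pmulr.
by apply: leq_trans (max_card _) _; rewrite card_prod !card_ord mulnn.
Qed.

(* Vertex v > 0 draws its parent among the smaller vertices; vertex 0 draws
   itself, which is not an edge. *)
Definition parents (v : 'I_n) : {set 'I_n} := [set u : 'I_n | u < v.-1.+1]%N.

Definition hidden_tree (c : {ffun 'I_n -> 'I_n}) : edge_set complete :=
  [set e : 'I_(ne complete) | (ends e).1 == c (ends e).2].

Lemma card_parents v : #|parents v| = v.-1.+1.
Proof. by rewrite card_ord_ltn; apply/minn_idPl; have := ltn_ord v; lia. Qed.

Lemma parents_lt (c : {ffun 'I_n -> 'I_n}) (v : 'I_n) :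
  c \in family parents -> (0 < v)%N -> (c v < v)%N.
Proof. by move=> /familyP/(_ v) + v0; rewrite inE prednK. Qed.

(** The smaller endpoint of a tree edge is the parent of the larger one. The cardinality bounds
    below therefore count larger endpoints. *)
Lemma hidden_tree_inj c :
  {in hidden_tree c &, injective (fun e : 'I_(ne complete) => (ends e).2)}.
Proof.
move=> e e'; rewrite !inE => /eqP He /eqP He' E; apply: ends_inj.
by rewrite [LHS]surjective_pairing [RHS]surjective_pairing He He' E.
Qed.

Lemma card_hidden_tree c : (0 < n)%N -> (#|hidden_tree c| < n)%N.
Proof.
move=> n0; rewrite -(card_in_imset (@hidden_tree_inj c)).
have -> : n = #|[set: 'I_n]| by rewrite cardsT card_ord.
apply: proper_card; apply/properP; split=> //; exists (Ordinal n0) => //.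
apply/imsetP => -[e _ E]; have := ends_lt e; by rewrite -E.
Qed.

Lemma card_hidden_tree_layer c j :
  (#|layer complete j :&: hidden_tree c| <= 2 ^ j)%N.
Proof.
rewrite -(card_in_imset (sub_in2 _ (@hidden_tree_inj c))); last first.
  by move=> e; rewrite inE => /andP[].
(* The larger endpoints in layer [j] lie in an interval of length [2 ^ j], on which reduction modulo
   [2 ^ j] is injective. *)
pose r (v : 'I_n) : 'I_(2 ^ j) := Ordinal (ltn_pmod v (expn_gt0 2 j)).
rewrite -[X in (_ <= X)%N]card_ord; apply: (@leq_card_in _ _ r).
move=> _ _ /imsetP[e + ->] /imsetP[e' + ->].
rewrite !in_setI !layerP => /andP[/andP[l1 l2] _] /andP[/andP[l1' l2'] _] [].
rewrite -(subnK l1) -(subnK l1') !modnDr !modn_small; last 2 first.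
- by rewrite ltn_subLR // addnn -mul2n -expnS.
- by rewrite ltn_subLR // addnn -mul2n -expnS.
by move/(congr1 (addn^~ (2 ^ j)%N)); rewrite !subnK //; apply: val_inj.
Qed.

Lemma hidden_adj c (u v : 'I_n) : c \in family parents ->
  adj (hidden_tree c) u v =
  ((u < v)%N && (u == c v)) || ((v < u)%N && (v == c u)).
Proof.
move=> cP; apply/idP/idP.
  case/existsP => e; rewrite inE => /andP[/eqP ec].
  by have := ends_lt e; move=> + /orP[] /eqP E; move: ec; rewrite E /= => -> ->;
    rewrite eqxx ?orbT.
case/orP => /andP[lt /eqP E]; have [e He] := completeP lt;
  by apply/existsP; exists e; rewrite !inE He /= E !eqxx ?orbT.
Qed.

Lemma hidden_tree_spanning c :
  c \in family parents -> spanning_tree (hidden_tree c).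
Proof.
move=> cP; split.
  have sym : symmetric (adj (hidden_tree c)).
    by move=> u v; rewrite !hidden_adj // orbC.
  (* Parents are strictly smaller, so following them leads down to vertex 0. *)
  have root (k : nat) (u v : 'I_n) :
      val v = 0%N -> (u < k)%N -> connect (adj (hidden_tree c)) u v.
    elim: k u => // k IH u v0 uk; have [u0|u0] := posnP u.
      by rewrite (_ : u = v) ?connect0 //; apply: val_inj; rewrite v0.
    have cu := parents_lt cP u0.
    apply: (@connect_trans _ _ (c u)); last exact: IH (leq_trans cu uk).
    by apply: connect1; rewrite hidden_adj // cu eqxx orbT.
  move=> u v; pose z : 'I_n := Ordinal (leq_ltn_trans (leq0n _) (ltn_ord u)).
  apply: (@connect_trans _ _ z); first exact: root (ltn_ord u).
  by rewrite (sym_connect_sym sym); apply: root (ltn_ord v).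
(* Both neighbours on a cycle of its largest vertex would be its parent. *)
move=> s s2 /andP[cyc us].
have [m ms maxm] : exists2 m, m \in s & forall x, x \in s -> (x <= m)%N.
  case: s s2 {cyc us} => // x0 s _.
  case: (@arg_maxnP _ x0 (fun x => x \in x0 :: s) val (mem_head _ _)) => m ms h.
  by exists m.
(* Once the cycle starts at [m], the neighbours of [m] are the second vertex [x] and the last vertex
   [y], distinct since there are more than two vertices. *)
have [i s' E] := rot_to ms.
move: cyc us; rewrite -(rot_cycle i) -(rot_uniq i) E => cyc us.
have := s2; rewrite -(size_rot i) E => {}s2.
have {}maxm x : x \in s' -> (x <= m)%N.
  by move=> xs; apply: maxm; rewrite -(mem_rot i) E inE xs orbT.
case: s' s2 E cyc us maxm => [|x s'] //; case/lastP: s' => // s' y _ _.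
rewrite [cycle _ _]/= rcons_path => /and3P[mx _].
rewrite last_rcons => ym us maxm.
have xm := maxm x (mem_head _ _).
have {}ymm : (y <= m)%N by apply: maxm; rewrite inE mem_rcons mem_head orbT.
move: mx ym us; rewrite !hidden_adj //.
rewrite (leq_gtF xm) (leq_gtF ymm) /= orbF => /andP[_ /eqP ->] /andP[_ /eqP ->].
by rewrite mem_rcons mem_head andbF.
Qed.

End CompleteGraph.

(** * Scarcity of the trees that a fixed set reveals *)

Lemma leq_card_bigcup (I T : finType) (A : I -> {set T}) :
  (#|\bigcup_i A i| <= \sum_i #|A i|)%N.
Proof.
elim/big_rec2: _ => [|i m D _ le]; first by rewrite cards0.
by rewrite (leq_trans (leq_of_leqif (leq_card_setU _ _))) // leq_add2l.
Qed.

Section Indistinguishable.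
Variable n : nat.
Implicit Types (c : {ffun 'I_n -> 'I_n}) (S : edge_set (complete n)).

(** With fewer than [b] tree edges in a layer, the inner truncation has no effect. With at least
    [3 * 2 ^ j] edges, at least [2 ^ j.+1] of them lie outside the tree, so both costs reach the
    cap. *)
Lemma layered_cost_neq L b c S :
  layered_cost L b (hidden_tree c) S != layered_cost L b set0 S ->
  exists2 j : 'I_L, (#|S :&: layer _ j| < 3 * 2 ^ j)%N &
    (b <= #|S :&: layer _ j :&: hidden_tree c|)%N.
Proof.
move=> neq; apply/exists_inP; apply: contraNT neq.
rewrite negb_exists => /forallP small; apply/eqP/eq_bigr => j _.
have /= := small j; rewrite negb_and -leqNgt -ltnNge.
have := cardsID (hidden_tree c) (S :&: layer _ j).
have : (#|S :&: layer _ j :&: hidden_tree c| <= 2 ^ j)%N.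
  apply: leq_trans (card_hidden_tree_layer c j).
  by apply/subset_leq_card/setSI/subsetIr.
rewrite /capped_card setD0 setI0 cards0 minn0 addn0 expnS.
move: #|_ :&: hidden_tree c| #|_ :\: _| #|S :&: layer _ j| (2 ^ j)%N.
lia.
Qed.

(** A vertex v > 0 has exactly v candidate parents, so each pair of [P] weighs at most 1 /
    [2 ^ j]. *)
Lemma parents_weight (R : realType) j (P : {set 'I_n * 'I_n}) :
  (forall p, p \in P -> 2 ^ j <= p.2)%N -> (#|P| < 3 * 2 ^ j)%N ->
  \sum_v #|[set u in parents v | (u, v) \in P]|%:R / #|parents v|%:R
    <= 3 :> R.
Proof.
move=> Pj Psmall; apply: (@le_trans _ _ (#|P|%:R / (2 ^ j)%:R)); last first.
  by rewrite ler_pdivrMr ?ltr0n ?expn_gt0 // -natrM ler_nat ltnW.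
apply: (@le_trans _ _ (\sum_v #|[set u | (u, v) \in P]|%:R / (2 ^ j)%:R)).
  apply: ler_sum => v _.
  have [->|/set0Pn[u]] := eqVneq [set u in parents v | (u, v) \in P] set0.
    by rewrite cards0 mul0r divr_ge0.
  rewrite inE => /andP[_ /Pj /= vj].
  apply: ler_pM => //; rewrite ?invr_ge0 //.
    rewrite ler_nat; apply/subset_leq_card/subsetP => w.
    by rewrite !inE => /andP[].
  rewrite lef_pV2 ?posrE ?ltr0n ?card_parents ?expn_gt0 // ler_nat prednK //.
  by rewrite (leq_trans _ vj) ?expn_gt0.
rewrite -mulr_suml ler_pM2r ?invr_gt0 ?ltr0n ?expn_gt0 // -natr_sum ler_nat.
rewrite -sum1_card.
rewrite (eq_bigl (fun p : 'I_n * 'I_n => (p.1, p.2) \in P)) => [|[]//].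
rewrite -(pair_big_dep xpredT (fun u v => (u, v) \in P) (fun _ _ => 1%N)) /=.
rewrite (exchange_big_dep xpredT) //=; apply: leq_sum => v _.
by rewrite -sum1_card; apply: eq_leq; apply: eq_bigl => u; rewrite inE.
Qed.

Lemma card_neq (R : realType) L b S :
  #|[set c in family (@parents n) |
      layered_cost L b (hidden_tree c) S != layered_cost L b set0 S]|%:R
    * 2 ^+ b <= L%:R * (expR 3 * #|family (@parents n)|%:R) :> R.
Proof.
pose P j := [set ends e | e in S :&: layer _ j].
(* Union bound over layers: one with at least [3 * 2 ^ j] edges never separates the costs, so no
   tree is charged to it. *)
pose B (j : 'I_L) := if (#|S :&: layer _ j| < 3 * 2 ^ j)%N then
  [set c in family (@parents n) | (b <= #|[set v | (c v, v) \in P j]|)%N]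
  else set0.
apply: (@le_trans _ _ (\sum_(j < L) #|B j|%:R * 2 ^+ b)).
  rewrite -mulr_suml ler_pM2r ?exprn_gt0 // -natr_sum ler_nat.
  apply: leq_trans (leq_card_bigcup _).
  apply/subset_leq_card/subsetP => c; rewrite inE => /andP[cQ].
  case/layered_cost_neq => j small hits; apply/bigcupP; exists j => //.
  rewrite /B small inE cQ; apply: leq_trans hits _.
  rewrite -(card_in_imset (sub_in2 _ (@hidden_tree_inj _ c))); last first.
    by move=> e; rewrite inE => /andP[].
  apply/subset_leq_card/subsetP => _ /imsetP[e + ->].
  rewrite !in_setI => /andP[eS]; rewrite !inE => /eqP <-.
  by rewrite -surjective_pairing imset_f // in_setI.
apply: (@le_trans _ _ (\sum_(j < L) expR 3 * #|family (@parents n)|%:R));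
  last by rewrite sumr_const card_ord mulr_natl.
apply: ler_sum => j _; rewrite /B; case: ifP => small; last first.
  by rewrite cards0 mul0r mulr_ge0 ?expR_ge0.
apply: le_trans (card_hits R (P j) b _) _.
  by move=> v; rewrite card_parents.
rewrite ler_wpM2r // ler_expR (@parents_weight _ j) //.
  by move=> _ /imsetP[e + ->]; rewrite in_setI layerP => /andP[_ /andP[]].
by rewrite card_imset //; apply: enum_val_inj.
Qed.

End Indistinguishable.

(** * Hard instances *)

Section HardInstance.
Variables (R : realType) (kappa : R) (L b : nat).
Hypotheses (kappa_ge0 : 0 <= kappa) (kappa_lt1 : kappa < 1).

Definition hard_cost (G : sgraph) (T S : edge_set G) : R :=
  kappa * (layered_cost L b T S)%:R + (1 - kappa) * #|S|%:R.

Local Notation K := (complete (2 ^ L)).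

Lemma hard_cost_mono (G : sgraph) (T : edge_set G) : monotone (hard_cost T).
Proof.
move=> A B AB; apply: lerD; apply: ler_wpM2l; rewrite ?subr_ge0 ?ler_nat //.
- exact: layered_cost_mono.
- exact: ltW.
- exact: subset_leq_card.
Qed.

Lemma hard_cost_submod (G : sgraph) (T : edge_set G) :
  submodular (hard_cost T).
Proof.
move=> A B; rewrite /hard_cost addrACA [leRHS]addrACA -!mulrDr -!natrD cardsUI.
by rewrite lerD2r ler_wpM2l // ler_nat layered_cost_submod.
Qed.

Lemma hard_cost_set0 (G : sgraph) (T : edge_set G) : hard_cost T set0 = 0.
Proof. by rewrite /hard_cost layered_cost_set0 cards0 !mulr0 addr0. Qed.

(** The top layer contains every pair joining the lower half of the vertices to the upper half. *)
Lemma card_top_layer m : L = m.+1 -> (2 ^ m * 2 ^ m <= #|layer K m|)%N.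
Proof.
move=> Lm; rewrite -(card_imset _ (@ends_inj K)).
pose U := [set v : 'I_(2 ^ L) | (v < 2 ^ m)%N].
have Um : #|U| = (2 ^ m)%N.
  by rewrite card_ord_ltn; apply/minn_idPl; rewrite Lm leq_exp2l.
have -> : (2 ^ m * 2 ^ m)%N = #|setX U (~: U)|.
  rewrite cardsX [#|~: U|]cardsCs setCK Um card_ord Lm expnS mul2n.
  by rewrite -addnn addnK.
apply/subset_leq_card/subsetP => -[u v].
rewrite !inE -leqNgt /= => /andP[um mv].
have [e He] := completeP (leq_trans um mv).
by rewrite -He imset_f // layerP He mv -Lm ltn_ord.
Qed.

(** The ratios are at least [1 - kappa] because the layered cost is monotone. Equality holds at an
    edge of the top layer, which stays at its cap when that edge is removed. *)
Lemma hard_cost_curvature c : (2 < L)%N -> (0 < b)%N ->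
  curvature (@hard_cost K (hidden_tree c)) = kappa.
Proof.
move=> L2 b0; set f := hard_cost _.
have f1 e : f [set e] = 1.
  by rewrite /f /hard_cost layered_cost_set1 // cards1 !mulr1 addrC subrK.
have ratioE e : curvature_ratio f e = (1 - kappa) +
    kappa * ((layered_cost L b (hidden_tree c) setT)%:R
           - (layered_cost L b (hidden_tree c) (~: [set e]))%:R).
  rewrite /curvature_ratio f1 divr1 /marginal setUCr /f /hard_cost.
  have -> : #|[set: 'I_(ne K)]|%:R = 1 + #|~: [set e]|%:R :> R.
    by rewrite -(setUCr [set e]) cardsU1 !inE eqxx natrD.
  by ring.
have lb : lbound (range (curvature_ratio f)) (1 - kappa).
  move=> _ [e _ <-]; rewrite ratioE lerDl mulr_ge0 // subr_ge0 ler_nat.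
  exact/layered_cost_mono/subsetT.
have [e He] : exists e, curvature_ratio f e = 1 - kappa.
  have [m Lm] : exists m, L = m.+1.
    by exists L.-1; rewrite prednK // ltnW // ltnW.
  have m1 : (1 < m)%N by rewrite -ltnS -Lm.
  have top := card_top_layer Lm.
  (* With x = [2 ^ m], removing one edge leaves at least x ^ 2 - 1 edges, at most x of them in the
     tree; x ^ 2 - 1 - x >= 2 x holds from x = 4 on, whence [2 < L]. *)
  have p4 : (4 <= 2 ^ m)%N by rewrite -[4%N]/(2 ^ 2)%N leq_exp2l.
  have /card_gt0P[e em] : (0 < #|layer K m|)%N.
    by apply: leq_trans top; rewrite muln_gt0 !expn_gt0.
  exists e; rewrite ratioE; apply/eqP; rewrite -subr_eq0 addrAC subrr add0r.
  rewrite mulf_eq0 subr_eq0 eqr_nat; apply/orP; right.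
  apply/eqP/eq_bigr => j _; rewrite setTI.
  have [jm|jm] := eqVneq (val j) m; last first.
    congr (capped_card _ _ _ _); apply/esym/setIidPr/subsetP => e'.
    rewrite !inE; apply: contraTneq => ->; move: em; rewrite inE => /eqP ->.
    by rewrite eq_sym.
  rewrite jm; have capped (A : edge_set K) : (#|layer K m| <= #|A|.+1)%N ->
      A \subset layer K m ->
      capped_card b (2 ^ m.+1) (hidden_tree c) A = (2 ^ m.+1)%N.
    move=> cA AE; have := cardsID (hidden_tree c) A.
    have : (#|A :&: hidden_tree c| <= 2 ^ m)%N.
      apply: leq_trans (card_hidden_tree_layer c m).
      by apply/subset_leq_card/setSI.
    rewrite /capped_card; have := leq_trans top cA; rewrite expnS.
    move: #|_ :&: _| #|_ :\: _| #|A| (2 ^ m)%N p4 => r d a x x4; nia.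
  rewrite !capped ?subsetIr //.
  by rewrite setIC -setDE (cardsD1 e (layer K m)) em.
rewrite /curvature; suff -> : inf (range (curvature_ratio f)) = 1 - kappa.
  by ring.
apply/eqP; rewrite eq_le; apply/andP; split.
  by rewrite -He; apply: ge_inf; [exists (1 - kappa) | exists e].
by apply: lb_le_inf => //; exists (curvature_ratio f e), e.
Qed.

Lemma hard_cost_instance c : c \in family (@parents (2 ^ L)) ->
  (2 < L)%N -> (0 < b)%N -> instance kappa (@hard_cost K (hidden_tree c)).
Proof.
move=> cQ L2 b0; split.
- have [con _] := hidden_tree_spanning cQ.
  move=> u v; apply: connect_sub (con u v) => x y /existsP[e /andP[_ xy]].
  by apply: connect1; apply/existsP; exists e; rewrite inE.
- move=> X; rewrite -(hard_cost_set0 (hidden_tree c)).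
  by rewrite hard_cost_mono ?sub0set.
- exact: hard_cost_set0.
- exact: hard_cost_mono.
- exact: hard_cost_submod.
- exact: hard_cost_curvature.
Qed.

(** Fallback for the runs that meet a revealing set: only the linear term is under control there. *)
Lemma hard_cost_ge (T X : edge_set K) : connected X ->
  (1 - kappa) * ((2 ^ L)%:R - 1) <= hard_cost T X.
Proof.
move=> /connected_size sX; rewrite -[leLHS]add0r.
apply: lerD; first by rewrite mulr_ge0.
rewrite ler_wpM2l ?subr_ge0 ?(ltW kappa_lt1) // lerBlDr natr1 ler_nat.
exact: sX.
Qed.

Lemma hard_cost0_ge (X : edge_set K) : connected X ->
  (2 ^ L)%:R - 1 <= hard_cost set0 X.
Proof.
move=> conX; have sX := connected_size conX.
have cX := connected_cost b conX (leqnn _).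
rewrite (_ : (2 ^ L)%:R - 1 = kappa * ((2 ^ L)%:R - 1)
  + (1 - kappa) * ((2 ^ L)%:R - 1)); last by ring.
apply: lerD; apply: ler_wpM2l; rewrite ?subr_ge0 ?(ltW kappa_lt1) //.
  by rewrite lerBlDr natr1 ler_nat; exact: cX.
by rewrite lerBlDr natr1 ler_nat; exact: sX.
Qed.

Lemma hard_cost_opt c : c \in family (@parents (2 ^ L)) ->
  opt (@hard_cost K (hidden_tree c)) <=
  kappa * (L * b)%:R + (1 - kappa) * ((2 ^ L)%:R - 1).
Proof.
move=> cQ.
apply: (@le_trans _ _ (@hard_cost K (hidden_tree c) (hidden_tree c))).
  apply: ge_inf; last first.
    by exists (hidden_tree c) => //; apply: hidden_tree_spanning.
  exists 0 => _ [X _ <-].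
  by rewrite -(hard_cost_set0 (hidden_tree c)) hard_cost_mono ?sub0set.
apply: lerD; apply: ler_wpM2l; rewrite ?subr_ge0 ?(ltW kappa_lt1) //.
  rewrite ler_nat -[X in (_ <= X * _)%N]card_ord -sum_nat_const.
  apply: leq_sum => j _; rewrite /capped_card (leq_trans (geq_minl _ _)) //.
  have /eqP -> : #|hidden_tree c :&: layer K j :\: hidden_tree c| == 0%N.
    by rewrite cards_eq0 setD_eq0 subsetIl.
  by rewrite add0n geq_minl.
by rewrite lerBrDr natr1 ler_nat card_hidden_tree ?expn_gt0.
Qed.

End HardInstance.

(** * Union bound and averaging *)

Section Averaging.
Variable R : realType.

Lemma card_has (I : finType) (T : Type) (D : {pred I}) (p : I -> pred T)
    (B M : R) (s : seq T) : 0 <= B ->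
  (forall x, #|[set i in D | p i x]|%:R * B <= M) ->
  #|[set i in D | has (p i) s]|%:R * B <= (size s)%:R * M.
Proof.
move=> B0 pM; elim: s => [|x s IH] /=.
  rewrite (_ : [set i in D | false] = set0) ?cards0 ?mul0r //.
  by apply/setP => i; rewrite !inE andbF.
rewrite -add1n natrD mulrDl mul1r; apply: le_trans (lerD (pM x) IH).
rewrite -mulrDl ler_wpM2r // -natrD ler_nat.
apply: leq_trans (leq_of_leqif (leq_card_setU _ _)).
by apply/subset_leq_card/subsetP => i; rewrite !inE -andb_orr.
Qed.

(** This turns a bound over trees for each coin sequence into a single tree that is rarely revealed.
    If every [i] failed, counting the pairs by [i] would exceed the count by [j]. *)
Lemma double_counting (I J : finType) (D : {pred I}) (p : I -> pred J)
    (B x : R) : (0 < #|D|)%N ->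
  (forall j, #|[set i in D | p i j]|%:R * B <= x * #|D|%:R) ->
  exists2 i, i \in D & #|[set j | p i j]|%:R * B <= x * #|J|%:R.
Proof.
move=> D0 le_avg; apply/exists_inP; apply: contraLR isT; rewrite negb_exists.
move=> /forallP large.
have sumE : \sum_(i in D) #|[set j | p i j]|%:R
            = \sum_j #|[set i in D | p i j]|%:R :> R.
  rewrite -!natr_sum; congr _%:R.
  under eq_bigr do rewrite -sum1_card.
  rewrite (exchange_big_dep xpredT) //=; apply: eq_bigr => j _.
  by rewrite -sum1_card; apply: eq_bigl => i; rewrite !inE.
have : \sum_(i in D) x * #|J|%:R < \sum_(i in D) #|[set j | p i j]|%:R * B.
  case/card_gt0P: D0 => i0 i0D; apply: ltr_sum => [|i iD].
    by apply/hasP; exists i0 => //; apply: mem_index_enum.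
  by have := large i; rewrite iD /= -ltNge.
rewrite -[ltRHS]mulr_suml sumE mulr_suml ltNge => /negP[].
apply: le_trans (ler_sum _ (fun j _ => le_avg j)) _.
by rewrite !sumr_const -[leLHS]mulr_natr -[leRHS]mulr_natr mulrAC.
Qed.

End Averaging.

(** * Runs against the decoy *)

Section Confusion.
Variables (R : realType) (prog : program R) (kappa : R) (L b : nat).

Local Notation K := (complete (2 ^ L)).
Local Notation decoy := (@hard_cost R kappa L b K set0).

Definition confusable c (S : edge_set K) :=
  layered_cost L b (hidden_tree c) S == layered_cost L b set0 S.

(* The runs in which the decoy cost meets a set on which it differs from the
   cost hiding c. *)
Definition exposes c (w : seq bool) : bool :=
  has (predC (confusable c)) (trace prog decoy (init_state R) w).

(** For fixed coins the run against the decoy does not depend on the tree, so it meets at most [N]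
    fixed sets and [card_neq] applies to each. Averaging then selects the tree. *)
Lemma exposes_rare N : exists2 c, c \in family (@parents (2 ^ L)) &
  #|[set w : N.-tuple bool | exposes c w]|%:R * 2 ^+ b
    <= N%:R * (L%:R * expR 3) * 2 ^+ N :> R.
Proof.
have fam0 : (0 < #|family (@parents (2 ^ L))|)%N.
  have L0 : (0 < 2 ^ L)%N by rewrite expn_gt0.
  apply/card_gt0P; exists [ffun=> Ordinal L0].
  by apply/familyP => v; rewrite ffunE inE.
have [|c] := @double_counting R _ (N.-tuple bool) _
  (fun c w => exposes c w) (2 ^+ b) (N%:R * (L%:R * expR 3)) fam0.
  move=> w; have neq := card_has (p := fun c => predC (confusable c))
    (trace prog decoy (init_state R) w) (exprn_ge0 b (ler0n R 2))
    (@card_neq _ R L b).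
  apply: le_trans neq _.
  rewrite -!mulrA ler_wpM2r ?mulr_ge0 ?expR_ge0 // ler_nat.
  by rewrite (leq_trans (size_trace _ _ _ _)) // size_tuple.
by rewrite card_tuple card_bool natrX => cQ; exists c.
Qed.

(** The run is the same under both costs, and its output belongs to the trace, where they agree. *)
Lemma not_exposed_cost c (w : seq bool) X : ~~ exposes c w ->
  run prog (@hard_cost R kappa L b K (hidden_tree c)) w = Some X ->
  @hard_cost R kappa L b K (hidden_tree c) X = decoy X.
Proof.
rewrite -all_predC => /allP same.
have eqf : {in trace prog decoy (init_state R) w,
    decoy =1 @hard_cost R kappa L b K (hidden_tree c)}.
  by move=> S /same /=; rewrite negbK => /eqP; rewrite /hard_cost => ->.
by rewrite /run -(eq_run_from eqf) => /run_from_trace /eqf.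
Qed.

End Confusion.

(** * Asymptotics of the factor *)

Section Factor.
Variables (R : realType) (kappa eps delta : R).
Hypotheses (kappa_ge0 : 0 <= kappa) (kappa_lt1 : kappa < 1).
Hypotheses (eps_gt0 : 0 < eps) (delta_gt0 : 0 < delta).

(** Here [x] is the number of vertices, [q] bounds the layered cost of the hidden tree, [v] is the
    cost obtained and [o] the optimum. With denominators cleared, the gap is at least [kappa] times
    a positive number: strict for [kappa > 0], weak for [kappa = 0], as the flag requires. *)
Lemma ratio_gap (N x q v o : R) : 0 < N -> N * (q + 1) <= x - 2 -> 0 <= q ->
  x - 1 - kappa <= v -> o <= kappa * q + (1 - kappa) * (x - 1) ->
  ~~ (v < N / (1 + (N - 1) * (1 - kappa) + delta * kappa) * o
      ?<= if (0 < kappa)%R).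
Proof.
move=> N0 Nq q0 xv oU.
have den0 : 0 < 1 + (N - 1) * (1 - kappa) + delta * kappa.
  have : 0 < N * (1 - kappa) by rewrite mulr_gt0 // subr_gt0.
  have : 0 <= delta * kappa by rewrite mulr_ge0 // ltW.
  by move: kappa_ge0; nra.
have pos : 0 < (x - 1 - kappa) * (1 + delta) - N * (q + (1 - kappa)).
  have Nk : 0 <= N * kappa by rewrite mulr_ge0 // ltW.
  have Nq0 : 0 <= N * (q + 1) by rewrite mulr_ge0 ?addr_ge0 // ltW.
  have x1 : 0 < x - 1 - kappa.
    by move: (le_trans Nq0 Nq) kappa_lt1; lra.
  have : 0 < (x - 1 - kappa) * delta by rewrite mulr_gt0.
  by move: Nk Nq kappa_lt1; lra.
have NoU := ler_wpM2l (ltW N0) oU.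
have gap : N * (kappa * q + (1 - kappa) * (x - 1)) +
   kappa * ((x - 1 - kappa) * (1 + delta) - N * (q + (1 - kappa)))
   = (x - 1 - kappa) * (1 + (N - 1) * (1 - kappa) + delta * kappa) by ring.
have [k0|k0] := boolP (0 < kappa).
  rewrite /= -ltNge mulrAC ltr_pdivrMr //.
  apply: (@lt_le_trans _ _ _ _ _ _ (ler_wpM2r (ltW den0) xv)).
  by apply: le_lt_trans NoU _; rewrite -gap ltrDl mulr_gt0.
rewrite /= -leNgt mulrAC ler_pdivrMr //.
apply: (@le_trans _ _ _ _ _ _ (ler_wpM2r (ltW den0) xv)).
by apply: le_trans NoU _; rewrite -gap lerDl mulr_ge0 // ltW.
Qed.

Lemma hardness_factor_gap (n : nat) (q v o : R) : (0 < n)%N ->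
  n%:R `^ (1 - 3 * eps) * (q + 1) <= n%:R - 2 ->
  0 <= q -> n%:R - 1 - kappa <= v ->
  o <= kappa * q + (1 - kappa) * (n%:R - 1) ->
  ~~ (v < hardness_factor kappa eps delta n * o ?<= if (0 < kappa)%R).
Proof. by move=> n0; apply: ratio_gap; rewrite powR_gt0 ?ltr0n. Qed.

Lemma eventually_gap (B : nat) (M : R) : exists L : nat,
  [/\ (2 < L)%N, M <= (2 ^ L)%:R &
   (2 ^ L)%:R `^ (1 - 3 * eps) * ((L * (B * L))%:R + 1) <= (2 ^ L)%:R - 2].
Proof.
(* For n = [2 ^ L], n ^ (3 eps) = e ^ (3 a L) >= (a L) ^ 3, and [y <= L] makes this at least 2 (B +
   1) L ^ 2. *)
pose a : R := eps * ln 2.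
have a0 : 0 < a by rewrite mulr_gt0 // ln_gt0 // ltr1n.
pose y : R := 2 * (B%:R + 1) / a ^+ 3.
pose L := (3 + Num.bound `|M| + Num.bound y)%N; exists L.
have y0 : 0 <= y.
  by apply: divr_ge0; [apply/mulr_ge0/addr_ge0 | apply/exprn_ge0/ltW].
have yL : y <= L%:R.
  by apply/ltW/(lt_le_trans (archi_boundP y0)); rewrite ler_nat leq_addl.
have L1 : 1 <= L%:R :> R by rewrite ler1n.
split=> //.
  apply: le_trans (ler_norm M) _.
  apply/ltW/(lt_le_trans (archi_boundP (normr_ge0 M))).
  rewrite ler_nat; apply/ltnW/(leq_ltn_trans _ (ltn_expl L (isT : 1 < 2)%N)).
  by rewrite /L addnAC leq_addl.
set n := (2 ^ L)%N.
have n8 : 8 <= n%:R :> R by rewrite ler_nat (@leq_exp2l 2 3).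
have n0 : 0 < n%:R :> R by lra.
have main : 2 * ((L * (B * L))%:R + 1) <= n%:R `^ (3 * eps).
  have -> : n%:R `^ (3 * eps) = expR (a * L%:R) ^+ 3.
    rewrite /powR gt_eqF // /n natrX lnXn // -expRM_natl; congr expR.
    by rewrite /a -mulr_natr; ring.
  apply: (@le_trans _ _ ((a * L%:R) ^+ 3)); last first.
    have := expR_ge1Dx (a * L%:R) => aL.
    have aL0 : 0 <= a * L%:R by rewrite mulr_ge0 // ltW.
    by apply: lerXn2r; rewrite ?nnegrE ?expR_ge0 //; lra.
  have : 2 * (B%:R + 1) <= a ^+ 3 * L%:R.
    by rewrite [leRHS]mulrC -ler_pdivrMr ?exprn_gt0.
  move=> /(ler_wpM2r (sqr_ge0 L%:R)); rewrite -[leRHS]mulrA -exprS -exprMn.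
  apply: le_trans; rewrite !natrM.
  have : 0 <= B%:R :> R by [].
  by move: L1; nra.
have nE : n%:R `^ (1 - 3 * eps) * n%:R `^ (3 * eps) = n%:R.
  by rewrite -powRD ?subrK ?powRr1 ?ltW // (gt_eqF n0) implybT.
(* This bounds the left-hand side by n / 2, which is at most n - 2 since n >= 8. *)
have := ler_wpM2l (powR_ge0 n%:R (1 - 3 * eps)) main.
by rewrite nE; nra.
Qed.

End Factor.

(** The exponent is the value chosen for [b]. With n = [2 ^ L], [T] is at most 2 cc n ^ (3 d), as 2
    n ^ 2 <= n ^ 3. Three more factors n pay for [L], for the constant 2 cc C, and for the n on the
    left, which brings the exposure probability down to 1 / n. *)
Lemma poly_time_slack (R : realType) (cc d T L : nat) (C : R) :
  0 <= C -> 2 * cc%:R * C <= (2 ^ L)%:R -> (0 < L)%N ->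
  (T <= cc * (2 * (2 ^ L) ^ 2) ^ d + cc)%N ->
  T%:R * (L%:R * C) * (2 ^ L)%:R <= 2 ^+ (3 * d.+1 * L) :> R.
Proof.
move=> C0 CL L0 TL.
have pow_le : ((2 * (2 ^ L) ^ 2) ^ d <= 2 ^ (3 * d * L))%N.
  rewrite -expnM -expnS -expnM leq_exp2l //.
  by have : (L * d >= d)%N; [rewrite leq_pmull | lia].
have {}TL : (T <= 2 * cc * 2 ^ (3 * d * L))%N.
  have := expn_gt0 2 (3 * d * L); move: TL pow_le; move: (2 ^ (3 * d * L))%N.
  move=> y; move: (_ ^ d)%N => z; nia.
have le1 : T%:R <= 2 * cc%:R * (2 ^ (3 * d * L))%:R :> R.
  by rewrite -!natrM ler_nat.
have le2 : L%:R <= (2 ^ L)%:R :> R by rewrite ler_nat ltnW // ltn_expl.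
have -> : 2 ^+ (3 * d.+1 * L) =
    (2 ^ (3 * d * L))%:R * (2 ^ L)%:R * (2 ^ L)%:R * (2 ^ L)%:R :> R.
  by rewrite -!natrM -!expnD -natrX; congr (_%:R); congr (2 ^ _)%N; lia.
rewrite ler_wpM2r //.
apply: (@le_trans _ _ (2 * cc%:R * (2 ^ (3 * d * L))%:R * ((2 ^ L)%:R * C))).
  by apply: ler_pM; rewrite ?mulr_ge0 // ler_wpM2r.
move: CL; set x := (2 ^ L)%:R; set y := (2 ^ _)%:R => CL.
have -> : 2 * cc%:R * y * (x * C) = y * x * (2 * cc%:R * C) by ring.
by rewrite ler_wpM2l // mulr_ge0.
Qed.

(** * Performance on a hard instance *)

Section HardRun.
Variables (R : realType) (kappa : R) (prog : program R) (t : sgraph -> nat).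
Variables (L b : nat) (c : {ffun 'I_(2 ^ L) -> 'I_(2 ^ L)}).
Hypotheses (kappa_ge0 : 0 <= kappa) (kappa_lt1 : kappa < 1).

Local Notation K := (complete (2 ^ L)).
Local Notation f := (@hard_cost R kappa L b K (hidden_tree c)).
Local Notation bad := (fun w : (t K).-tuple bool => exposes prog kappa b c w).

Hypothesis rare : #|[set w | bad w]|%:R * (2 ^ L)%:R <= 2 ^+ t K :> R.

Lemma unexposed_cost_ge w X : ~~ bad w -> run prog f w = Some X ->
  connected X -> (2 ^ L)%:R - 1 <= f X.
Proof. by move=> /not_exposed_cost H /H -> /hard_cost0_ge; apply. Qed.

(** With x = n - 1, an exposed run costs at least (1 - kappa) x and any other at least x. At most a
    1 / n fraction is exposed, so the mean loses at most kappa x / n <= kappa. *)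
Lemma expected_value_ge :
  (forall w : (t K).-tuple bool,
     exists2 X, run prog f w = Some X & spanning_tree X) ->
  (2 ^ L)%:R - 1 - kappa <= expected_value prog t f.
Proof.
move=> out; set x := _ - 1; rewrite ler_pdivlMr ?exprn_gt0 //.
apply: (@le_trans _ _ (\sum_(w : (t K).-tuple bool)
    (x - kappa * x * (bad w)%:R))).
  rewrite sumrB sumr_const card_tuple card_bool -mulr_sumr -natr_sum.
  rewrite (_ : (\sum_w nat_of_bool (bad w))%N = #|[set w | bad w]|); last first.
    rewrite -sum1_card [RHS]big_mkcond; apply: eq_bigr => w _.
    by rewrite inE; case: exposes.
  rewrite -[x *+ _]mulr_natr natrX mulrBl lerD2l lerN2 -mulrA ler_wpM2l //.
  apply: le_trans rare; rewrite mulrC ler_wpM2l //.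
  by rewrite lerBlDr lerDl.
apply: ler_sum => w _; have [X runX [conX _]] := out w; rewrite runX.
have [_|unexposed] := boolP (bad w).
  have := hard_cost_ge b kappa_ge0 kappa_lt1 (hidden_tree c) conX.
  by apply: le_trans; rewrite /x mulr1 mulrBl mul1r.
by rewrite mulr0 subr0; apply: unexposed_cost_ge runX conX.
Qed.

Lemma probability_rare (P : pred ((t K).-tuple bool)) (p : R) :
  p^-1 < (2 ^ L)%:R -> 0 < p -> (forall w, P w -> bad w) ->
  probability R P < p.
Proof.
move=> pn p0 sub; rewrite /probability ltr_pdivrMr ?exprn_gt0 //.
apply: (@le_lt_trans _ _ #|[set w | bad w]|%:R).
  by rewrite ler_nat; apply/subset_leq_card/subsetP => w; rewrite !inE => /sub.
have n0 : 0 < (2 ^ L)%:R :> R by rewrite ltr0n expn_gt0.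
rewrite -(ltr_pM2r n0); apply: le_lt_trans rare _.
rewrite mulrAC -[ltLHS]mul1r ltr_pM2r ?exprn_gt0 //.
by rewrite -ltr_pdivrMl // mulr1.
Qed.

End HardRun.

(* For kappa = 0 the factor is 1, which Kruskal's algorithm attains: there the
   claim is that no algorithm does strictly better than the factor. *)
Theorem theorem7 (R : realType) (kappa eps delta : R)
    (kappa_ge0 : 0 <= kappa) (kappa_lt1 : kappa < 1)
    (eps_gt0 : 0 < eps) (delta_gt0 : 0 < delta)
    (prog : program R) (t : sgraph -> nat)
    (t_poly : polynomial_bound t) (prog_time : runs_in_time kappa prog t) :
  ~ achieves_factor (0 < kappa) kappa prog t (hardness_factor kappa eps delta).
Proof.
case: t_poly => cc [d tP] [n0 ach].
pose e3 : R := expR 3; have e30 : 0 <= e3 := expR_ge0 3.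
(* Both kinds of guarantee are refuted on the same instance. In the expectation case [p] is a dummy,
   set to 1 below. *)
have refute (p : R) : 0 < p ->
    ~ (forall (G : sgraph) (f : edge_set G -> R),
         (n0 <= nv G)%N -> instance kappa f ->
         good_in_expectation prog t f (0 < kappa)
           (hardness_factor kappa eps delta (nv G)) \/
         good_with_probability prog t f (0 < kappa)
           (hardness_factor kappa eps delta (nv G)) p).
  move=> p0 good.
  (* The summands ensure n >= n0, n >= 2 cc e ^ 3 for [poly_time_slack], and n > 1 / p, the final 1
     giving strictness. *)
  have [L [L2 LM gap]] := eventually_gap eps_gt0 (3 * d.+1)
    (n0%:R + 2 * cc%:R * e3 + p^-1 + 1).
  have [n00 cc0 pV0] : [/\ 0 <= n0%:R :> R, 0 <= 2 * cc%:R * e3 & 0 <= p^-1].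
    by split; rewrite ?mulr_ge0 ?invr_ge0 // ltW.
  have nL : (n0 <= 2 ^ L)%N by rewrite -(ler_nat R); lra.
  have L0 : (0 < L)%N := ltn_trans (isT : 0 < 2)%N L2.
  have N0 : (0 < 2 ^ L)%N by rewrite expn_gt0.
  pose K := complete (2 ^ L); pose b := (3 * d.+1 * L)%N.
  have b0 : (0 < b)%N by rewrite !muln_gt0 L0.
  have [c cQ /= cfew] := exposes_rare prog kappa L b (t K).
  have rare : #|[set w : (t K).-tuple bool | exposes prog kappa b c w]|%:R
      * (2 ^ L)%:R <= 2 ^+ t K :> R.
    have tK : (t K <= cc * (2 * (2 ^ L) ^ 2) ^ d + cc)%N.
      apply: leq_trans (tP K) _; rewrite leq_add2r leq_mul2l.
      have [->|d0] := posnP d;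
        by rewrite ?expn0 ?leq_exp2r ?complete_size ?orbT.
    have CL : 2 * cc%:R * e3 <= (2 ^ L)%:R by lra.
    have slack := poly_time_slack e30 CL L0 tK.
    have B0 : 0 < 2 ^+ b :> R by rewrite exprn_gt0.
    rewrite -(ler_pM2r B0) mulrAC.
    apply: le_trans (ler_wpM2r (ler0n R (2 ^ L)) cfew) _.
    by rewrite mulrAC [leRHS]mulrC ler_wpM2r // exprn_ge0.
  have gapK v := hardness_factor_gap kappa_ge0 kappa_lt1 delta_gt0 N0 gap
    (ler0n _ _) (v := v) ^~ (hard_cost_opt b kappa_ge0 kappa_lt1 cQ).
  have inst := hard_cost_instance kappa_ge0 kappa_lt1 cQ L2 b0.
  case: (good K _ nL inst) => [[out]|].
    by apply/negP/gapK/expected_value_ge.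
  rewrite /good_with_probability leNgt => /negP[].
  apply: (probability_rare rare) => //; first by lra.
  move=> w; case runX: run => [X|//] /andP[/asboolP[conX _]].
  (* An unexposed run that outputs a spanning tree costs at least n - 1, too much for the factor. *)
  apply: contraLR => unexposed; apply: gapK.
  apply: le_trans (unexposed_cost_ge kappa_ge0 kappa_lt1 unexposed runX conX).
  by rewrite lerBlDr lerDl.
case: ach => [good|[p p0 good]].
  by apply: (refute 1 ltr01) => G f nG inst; left; apply: good.
by apply: (refute p p0) => G f nG inst; right; apply: good.
Qed.
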